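(* Let $m,n,s\ge 1$ be integers, let $T>0$, let $f:[0,T]\times\mathbb{R}^m\to\mathbb{R}^m$ be Lipschitz in the second variable with Lipschitz function $L(\cdot)\in L^\infty([0,T])$, i.e. $\|f(t,x)-f(t,y)\|_2\le L(t)\|x-y\|_2$ for all $(t,x),(t,y)\in[0,T]\times\mathbb{R}^m$, and let $L:=\|L(\cdot)\|_{L^\infty([0,T])}>0$. Let $A$ be a real $n\times m$ matrix with isometry constant $\delta_{2s}$, let $w_1,\dots,w_m>0$ be weights, and let $\tau:=\max_{1\le i\le m}w_i/\min_{1\le i\le m}w_i$. Suppose that $$\delta_{2s}<(1+\tau\sqrt2)^{-1}\quad\text{and}\quad T<\frac1L\ln\left(1+\frac{1-\delta_{2s}(1+\tau\sqrt2)}{(1+\tau)\|A\|\sqrt{1+\delta_{2s}}}\right).$$ Then there exist constants $C_0$ and $C_1$, independent of $x^0$, such that the following holds for every $\epsilon\ge 0$, every $x^0\in\mathbb{R}^m$ and every $e\in\mathbb{R}^n$ with $\|e\|_2\le\epsilon$. Let $b=Ax(T)+e$, where $x(\cdot)$ is the solution of $\dot x(t)=f(t,x(t))$, $t>0$, with $x(0)=x^0$. Then the solution $x^*$ of the problem $(P_{1,w}^\epsilon)$ with data $b$ satisfies $$\|x^*-x^0\|_2\le C_0\,s^{-1/2}\|x^0-x^0_s\|_1+C_1\epsilon .$$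
   Context: For $x\in\mathbb{R}^m$: $\|x\|_0:=\#\{i:x_i\ne0\}$; $\|x\|_p:=(\sum_{i=1}^m|x_i|^p)^{1/p}$ for $p\ge1$; $\|x\|_{1,w}:=\sum_{i=1}^m w_i|x_i|$. $\|A\|$ is the operator norm of $A$ induced by the Euclidean norms. For a vector $x$, $x_s$ denotes the vector having only the $s$ largest (in absolute value) entries of $x$, the others being set to zero; thus $x^0_s=(x^0)_s$. For each integer $k\ge1$, the isometry constant $\delta_k$ of $A$ is the smallest number such that $(1-\delta_k)\|x\|_2^2\le\|Ax\|_2^2\le(1+\delta_k)\|x\|_2^2$ holds for all $x\in\mathbb{R}^m$ with $\|x\|_0\le k$. A solution of the initial value problem $\dot x(t)=f(t,x(t))$, $x(0)=z$, on $[0,T]$ is a continuous function $x:[0,T]\to\mathbb{R}^m$ such that $t\mapsto f(t,x(t))$ is integrable and $x(t)=z+\int_0^t f(\sigma,x(\sigma))\,d\sigma$ for all $t\in[0,T]$. It is assumed that for every initial vector $z\in\mathbb{R}^m$ such a solution exists (it is then unique by the Lipschitz condition). Problem $(P_{1,w}^\epsilon)$ with data $b\in\mathbb{R}^n$: find $$x^*:=\arg\min\{\|z\|_{1,w}: z\in\mathbb{R}^m,\ \|b-Ax(T;z)\|_2\le\epsilon\},$$ where $x(\cdot\,;z)$ is the solution of $\dot x(t)=f(t,x(t))$ with initial condition $x(0)=z$. ''The solution $x^*$'' means any minimizer of this problem. *)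

(* Defs.v *)
From HB Require Import structures.
From mathcomp Require Import all_boot all_order all_algebra.
From mathcomp Require Import all_classical all_reals all_analysis.

Set Implicit Arguments.
Unset Strict Implicit.
Unset Printing Implicit Defensive.

Import Order.TTheory GRing.Theory Num.Theory.
Import numFieldNormedType.Exports.

Local Open Scope classical_set_scope.
Local Open Scope ring_scope.

Section Vectors.
Context {R : realType} {m : nat}.
Implicit Types (x y : 'cV[R]_m) (w : 'I_m -> R).

Definition l0norm x : nat := #|[set i | x i 0 != 0]%SET|.

Definition l1norm x : R := \sum_(i < m) `|x i 0|.

Definition l2norm x : R := Num.sqrt (\sum_(i < m) `|x i 0| ^+ 2).

Definition wl1norm w x : R := \sum_(i < m) w i * `|x i 0|.

(* For positive [w] and [0 < m], the default values [0] and [wmax w] do not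
   affect the result. *)
Definition wmax w : R := \big[Num.max/0]_(i < m) w i.
Definition wmin w : R := \big[Num.min/wmax w]_(i < m) w i.

(* [y] keeps the [s] entries of [x] that are largest in absolute value (all of
   them when [m <= s]) and is zero elsewhere. A relation, because ties make
   several [y] possible. *)
Definition largest_part (s : nat) x y : Prop :=
  exists S : {set 'I_m},
    [/\ #|S| = minn s m,
        forall i j, i \in S -> j \notin S -> `|x j 0| <= `|x i 0| &
        y = \col_i (if i \in S then x i 0 else 0)].

End Vectors.

Section Matrices.
Context {R : realType} {n m : nat}.
Implicit Types (A : 'M[R]_(n, m)).

Definition opnorm A : R :=
  sup [set l2norm (A *m x) | x in [set x : 'cV[R]_m | l2norm x <= 1]].

Definition restricted_isometry A (k : nat) (d : R) : Prop :=
  forall x : 'cV[R]_m, (l0norm x <= k)%N ->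
    (1 - d) * l2norm x ^+ 2 <= l2norm (A *m x) ^+ 2 <= (1 + d) * l2norm x ^+ 2.

Definition isometry_constant A (k : nat) (d : R) : Prop :=
  restricted_isometry A k d /\
  forall d', restricted_isometry A k d' -> d <= d'.

End Matrices.

Section InitialValueProblem.
Context {R : realType} {m : nat}.
Implicit Types (f : R -> 'cV[R]_m -> 'cV[R]_m) (x : R -> 'cV[R]_m).

(* The completed measure gives measurability and integrability in the sense of
   Lebesgue; [lebesgue_measure] only knows the Borel sets. *)
Local Notation mu := (@completed_lebesgue_measure R).

(* Only the values of [f] and [x] at times in [0, T] are constrained. *)
Definition ivp_solution f (T : R) (z : 'cV[R]_m) x : Prop :=
  [/\ {within `[0, T], continuous x},
      forall i, mu.-integrable `[0, T] (fun t => (f t (x t) i 0)%:E) &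
      forall t, t \in `[0, T] -> forall i,
        x t i 0 = z i 0 + \int[mu]_(u in `[0, t]) f u (x u) i 0].

(* [L] belongs to L^oo([0, T]) and its norm there is [l], both expressed
   through the extension of [L] by zero. *)
Definition Linfty_norm_on (T : R) (L : R -> R) (l : R) : Prop :=
  let L0 := patch (fun=> 0) `[0, T] L in
  L0 \in Lfun mu +oo%E /\ 'N[mu]_+oo[EFin \o L0]%E = l%:E.

Definition lipschitz_snd f (T : R) (L : R -> R) : Prop :=
  forall t, t \in `[0, T] -> forall x y : 'cV[R]_m,
    l2norm (f t x - f t y) <= L t * l2norm (x - y).

Definition feasible {n : nat} f (T : R) (A : 'M[R]_(n, m)) (b : 'cV[R]_n)
    (eps : R) (z : 'cV[R]_m) : Prop :=
  exists2 x, ivp_solution f T z x & l2norm (b - A *m x T) <= eps.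

Definition wl1_minimizer {n : nat} f (T : R) (A : 'M[R]_(n, m))
    (w : 'I_m -> R) (b : 'cV[R]_n) (eps : R) (xs : 'cV[R]_m) : Prop :=
  feasible f T A b eps xs /\
  forall z, feasible f T A b eps z -> wl1norm w xs <= wl1norm w z.

End InitialValueProblem.

(* Main.v *)
Require Import Defs.
From HB Require Import structures.
From mathcomp Require Import all_boot all_order all_algebra.
From mathcomp Require Import all_classical all_reals all_analysis.
From mathcomp Require Import measurable_realfun ess_sup_inf.
From mathcomp Require Import ring lra.
Set Implicit Arguments.
Unset Strict Implicit.
Unset Printing Implicit Defensive.
Import Order.TTheory GRing.Theory Num.Theory.
Import numFieldNormedType.Exports.
Local Open Scope classical_set_scope.
Local Open Scope ring_scope.

(* Put h = xstar - x0. A Gronwall argument shows that the flow moves h by at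
   most (exp(L T) - 1) |h|, so that feasibility of xstar and x0 gives
     |A h| <= 2 eps + |A| (exp(L T) - 1) |h|.
   Minimality of xstar gives a cone condition: on the complement of the support
   S of x0s, the l1 norm of h is at most tau times its l1 norm on S, plus
   2 tau |x0 - x0s|_1. The restricted isometry argument of Candes bounds h on S
   and the next s largest entries by |A h| and the l1 norm of h off S. The bound
   on T makes the coefficient of |h| small enough to be absorbed on the left. *)

(** * Inner product and Euclidean norm on column vectors *)

Section EuclideanNorm.
Context {R : realType}.

Definition dot {m} (x y : 'cV[R]_m) : R := \sum_(i < m) x i 0 * y i 0.

Context {m : nat}.
Implicit Types x y z : 'cV[R]_m.

Lemma dotC x y : dot x y = dot y x.
Proof. by apply: eq_bigr => i _; rewrite mulrC. Qed.

Lemma dotDl x y z : dot (x + y) z = dot x z + dot y z.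
Proof. by rewrite -big_split; apply: eq_bigr => i _; rewrite mxE mulrDl. Qed.

Lemma dotDr x y z : dot x (y + z) = dot x y + dot x z.
Proof. by rewrite !(dotC x) dotDl. Qed.

Lemma dotZl (a : R) x y : dot (a *: x) y = a * dot x y.
Proof. by rewrite mulr_sumr; apply: eq_bigr => i _; rewrite mxE mulrA. Qed.

Lemma dotZr (a : R) x y : dot x (a *: y) = a * dot x y.
Proof. by rewrite dotC dotZl dotC. Qed.

Lemma dotNr x y : dot x (- y) = - dot x y.
Proof. by rewrite -scaleN1r dotZr mulN1r. Qed.

Lemma dot0l y : dot 0 y = 0.
Proof. by rewrite -(scale0r (0 : 'cV[R]_m)) dotZl mul0r. Qed.

Lemma dot0r x : dot x 0 = 0.
Proof. by rewrite dotC dot0l. Qed.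

Lemma dot_ge0 x : 0 <= dot x x.
Proof. by apply: sumr_ge0 => i _; rewrite -expr2 sqr_ge0. Qed.

Lemma l2norm_sqr x : l2norm x ^+ 2 = dot x x.
Proof.
rewrite sqr_sqrtr; last by apply: sumr_ge0 => i _; rewrite sqr_ge0.
by apply: eq_bigr => i _; rewrite real_normK ?num_real// expr2.
Qed.

Lemma l2norm_ge0 x : 0 <= l2norm x.
Proof. exact: sqrtr_ge0. Qed.

Lemma le_l2norm x (c : R) : 0 <= c -> (l2norm x <= c) = (dot x x <= c ^+ 2).
Proof. by move=> c0; rewrite -l2norm_sqr ler_sqr// nnegrE l2norm_ge0. Qed.

Lemma l2norm0_eq0 x : l2norm x = 0 -> x = 0.
Proof.
move=> /eqP; rewrite -sqrf_eq0 l2norm_sqr psumr_eq0 => [/allP x0|i _]; last first.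
  by rewrite -expr2 sqr_ge0.
apply/matrixP => i j; rewrite ord1 mxE; apply/eqP.
by have := x0 i; rewrite mem_index_enum mulf_eq0 orbb; apply.
Qed.

Lemma l2norm0 : l2norm (0 : 'cV[R]_m) = 0.
Proof.
by apply/eqP; rewrite -sqrf_eq0 l2norm_sqr dot0l.
Qed.

Lemma l2normZ (a : R) x : l2norm (a *: x) = `|a| * l2norm x.
Proof.
apply/eqP; rewrite -(@eqrXn2 _ 2%N) ?mulr_ge0 ?l2norm_ge0// exprMn !l2norm_sqr.
by rewrite dotZl dotZr real_normK ?num_real// mulrA expr2.
Qed.

Lemma l2normN x : l2norm (- x) = l2norm x.
Proof. by rewrite -scaleN1r l2normZ normrN1 mul1r. Qed.

Lemma dot_le x y : dot x y <= l2norm x * l2norm y.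
Proof.
have [x0|x0] := eqVneq (l2norm x) 0.
  by rewrite x0 mul0r (l2norm0_eq0 x0) dot0l.
have [y0|y0] := eqVneq (l2norm y) 0.
  by rewrite y0 mulr0 (l2norm0_eq0 y0) dot0r.
have xy0 : 0 < l2norm x * l2norm y by rewrite mulr_gt0// lt_def ?x0 ?y0 l2norm_ge0.
(* Cauchy-Schwarz: this squared norm equals 2 |x| |y| (|x| |y| - <x, y>), and the factor 2 |x| |y|
   is positive. *)
have := dot_ge0 (l2norm y *: x - l2norm x *: y).
rewrite -scaleNr !(dotDl, dotDr, dotZl, dotZr) -!l2norm_sqr (dotC y x).
rewrite [X in 0 <= X](_ : _ = (l2norm x * l2norm y *+ 2) *
  (l2norm x * l2norm y - dot x y)); last by ring.
by rewrite pmulr_rge0 ?subr_ge0// mulrn_wgt0.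
Qed.

Lemma normr_dot_le x y : `|dot x y| <= l2norm x * l2norm y.
Proof. by rewrite ler_norml dot_le andbT lerNl -dotNr -(l2normN y) dot_le. Qed.

Lemma ler_l2normD x y : l2norm (x + y) <= l2norm x + l2norm y.
Proof.
rewrite le_l2norm ?addr_ge0 ?l2norm_ge0// dotDl !dotDr -!l2norm_sqr (dotC y x).
by have := dot_le x y; set a := l2norm x; set b := l2norm y; nra.
Qed.

Lemma ler_l2normB x y : l2norm (x - y) <= l2norm x + l2norm y.
Proof. by rewrite -(l2normN y) ler_l2normD. Qed.

Lemma ler_l2norm_addB x y : l2norm x <= l2norm y + l2norm (x - y).
Proof. by have := ler_l2normD y (x - y); rewrite addrCA subrr addr0. Qed.

Lemma ler_coord_l2norm x i : `|x i 0| <= l2norm x.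
Proof.
rewrite -ler_sqr ?nnegrE ?l2norm_ge0// l2norm_sqr real_normK ?num_real//.
by rewrite /dot (bigD1 i)//= -expr2 lerDl sumr_ge0// => j _; rewrite -expr2 sqr_ge0.
Qed.

Lemma l2norm_le_l1norm x : l2norm x <= l1norm x.
Proof.
rewrite le_l2norm ?sumr_ge0// expr2 /l1norm mulr_suml.
apply: ler_sum => i _; rewrite (le_trans (ler_norm _))// normrM.
by apply: ler_wpM2l => //; rewrite (bigD1 i)//= lerDl sumr_ge0.
Qed.

End EuclideanNorm.

(** * The operator norm *)

Section OperatorNorm.
Context {R : realType} {n m : nat}.
Implicit Types (A : 'M[R]_(n, m)) (x : 'cV[R]_m).

(** A crude bound, whose purpose is to show that the set whose supremum defines [opnorm] is bounded
    above. *)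
Lemma l2norm_mulmx_le_sum A x :
  l2norm (A *m x) <= (\sum_i \sum_j `|A i j|) * l2norm x.
Proof.
rewrite (le_trans (l2norm_le_l1norm _))// mulr_suml; apply: ler_sum => i _.
rewrite mxE (le_trans (ler_norm_sum _ _ _))// mulr_suml; apply: ler_sum => j _.
by rewrite normrM ler_wpM2l// ler_coord_l2norm.
Qed.

Lemma opnorm_has_sup A :
  has_sup [set l2norm (A *m x) | x in [set x : 'cV[R]_m | l2norm x <= 1]].
Proof.
split; first by exists (l2norm (A *m 0)), 0 => //=; rewrite l2norm0.
exists (\sum_i \sum_j `|A i j|) => _ [x /= x1 <-].
apply: (le_trans (l2norm_mulmx_le_sum A x)).
by rewrite ler_piMr// !sumr_ge0// => i _; rewrite sumr_ge0.
Qed.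

Lemma opnorm_ge0 A : 0 <= opnorm A.
Proof.
apply: (@le_trans _ _ (l2norm (A *m 0))); first exact: l2norm_ge0.
by apply: (ub_le_sup (opnorm_has_sup A).2); exists 0 => //=; rewrite l2norm0.
Qed.

Lemma l2norm_mulmx_le A x : l2norm (A *m x) <= opnorm A * l2norm x.
Proof.
have [x0|x0] := eqVneq (l2norm x) 0.
  by rewrite (l2norm0_eq0 x0) mulmx0 !l2norm0 mulr0.
have x_gt0 : 0 < l2norm x by rewrite lt_def x0 l2norm_ge0.
rewrite -ler_pdivrMr// mulrC.
have -> : (l2norm x)^-1 * l2norm (A *m x) = l2norm (A *m ((l2norm x)^-1 *: x)).
  by rewrite -scalemxAr l2normZ ger0_norm// invr_ge0 ltW.
apply: (ub_le_sup (opnorm_has_sup A).2); exists ((l2norm x)^-1 *: x) => //=.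
by rewrite l2normZ ger0_norm ?invr_ge0 ?(ltW x_gt0)// mulVf.
Qed.

End OperatorNorm.

(** * Restriction of a vector to a set of indices *)

Lemma disjoint_setD {T : finType} (B U : {set T}) : [disjoint B & U :\: B]%B.
Proof.
rewrite -setI_eq0; apply/eqP/finset.setP => i; rewrite !inE.
by case: (i \in B); rewrite ?andbF.
Qed.

Section Restriction.
Context {R : realType} {m : nat}.
Implicit Types (x y : 'cV[R]_m) (S U B C : {set 'I_m}).

Definition restr S x : 'cV[R]_m := \col_i (if i \in S then x i 0 else 0).

Lemma dot_restr S x : dot (restr S x) (restr S x) = \sum_(i in S) x i 0 ^+ 2.
Proof.
rewrite [RHS]big_mkcond; apply: eq_bigr => i _; rewrite !mxE.
by case: ifP => _; rewrite ?mul0r// expr2.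
Qed.

Lemma dot_restr_disjoint S U x y : [disjoint S & U]%B ->
  dot (restr S x) (restr U y) = 0.
Proof.
move=> SU; rewrite /dot big1// => i _; rewrite !mxE.
by case: ifP => [/(disjointFr SU)->|_]; rewrite ?mul0r// mulr0.
Qed.

Lemma l1norm_restr S x : l1norm (restr S x) = \sum_(i in S) `|x i 0|.
Proof.
rewrite [RHS]big_mkcond; apply: eq_bigr => i _; rewrite !mxE.
by case: ifP => _; rewrite ?normr0.
Qed.

Lemma restrU B C x : [disjoint B & C]%B ->
  restr (B :|: C) x = restr B x + restr C x.
Proof.
move=> BC; apply/matrixP => i j; rewrite !mxE inE.
by case: ifP => [/orP[iB|iC]|/norP[/negPf-> /negPf->]]; rewrite ?addr0//;
  [rewrite iB (disjointFr BC iB) addr0|rewrite iC (disjointFl BC iC) add0r].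
Qed.

Lemma l1norm_restrU B C x : [disjoint B & C]%B ->
  l1norm (restr (B :|: C) x) = l1norm (restr B x) + l1norm (restr C x).
Proof.
move=> BC; rewrite !l1norm_restr -bigU//=.
by apply: eq_bigl => i; rewrite !inE.
Qed.

Lemma restr0 x : restr finset.set0 x = 0.
Proof. by apply/matrixP => i j; rewrite !mxE inE. Qed.

Lemma restrC S x : x = restr S x + restr (~: S) x.
Proof.
apply/matrixP => i j; rewrite ord1 !mxE inE.
by case: ifP => _; rewrite ?addr0// add0r.
Qed.

Lemma l0norm_restr S x (k : nat) : (#|S| <= k)%N -> (l0norm (restr S x) <= k)%N.
Proof.
apply: leq_trans; apply/subset_leq_card/fintype.subsetP => i.
by rewrite inE mxE; case: ifP => //; rewrite eqxx.
Qed.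

Lemma l2norm_restr_le S U x : S \subset U ->
  l2norm (restr S x) <= l2norm (restr U x).
Proof.
move=> SU; rewrite le_l2norm ?l2norm_ge0// l2norm_sqr !dot_restr.
rewrite [leRHS](big_setID S)/= (finset.setIidPr SU) lerDl sumr_ge0// => i _.
exact: sqr_ge0.
Qed.

Lemma l2norm_restr_le_sup S x (k : nat) (M : R) : (#|S| <= k)%N -> 0 <= M ->
  (forall i, i \in S -> `|x i 0| <= M) -> l2norm (restr S x) <= Num.sqrt k%:R * M.
Proof.
move=> Sk M0 xM; rewrite le_l2norm ?mulr_ge0 ?sqrtr_ge0// exprMn sqr_sqrtr//.
rewrite dot_restr (@le_trans _ _ (\sum_(i in S) M ^+ 2))//.
  apply: ler_sum => i iS; rewrite -[leLHS]real_normK ?num_real//.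
  by rewrite ler_sqr ?nnegrE// xM.
by rewrite sumr_const mulr_natl ler_wpMn2l ?sqr_ge0.
Qed.

(** Cauchy-Schwarz against the sign vector of [x] cut down to [S], whose Euclidean norm is at most
    sqrt k. *)
Lemma l1norm_restr_le S x (k : nat) : (#|S| <= k)%N ->
  l1norm (restr S x) <= Num.sqrt k%:R * l2norm (restr S x).
Proof.
move=> Sk; pose e : 'cV[R]_m := \col_i Num.sg (x i 0).
have -> : l1norm (restr S x) = dot (restr S e) (restr S x).
  rewrite l1norm_restr big_mkcond; apply: eq_bigr => i _; rewrite !mxE.
  by case: ifP => _; rewrite ?mulr0// -normrEsg.
rewrite (le_trans (dot_le _ _))// ler_wpM2r ?l2norm_ge0//.
rewrite -[leRHS]mulr1 l2norm_restr_le_sup// => i _.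
by rewrite mxE normr_sg lern1 leq_b1.
Qed.

End Restriction.

(** * Decomposition into blocks of decreasing entries *)

Section SortedBlocks.
Context {R : realType} {m : nat}.
Implicit Types (h : 'cV[R]_m) (U B C : {set 'I_m}).

Lemma top_subset_card h U (k : nat) : (k <= #|U|)%N ->
  exists B (M : R), [/\ B \subset U, #|B| = k, 0 <= M,
    forall i, i \in B -> M <= `|h i 0| &
    forall i, i \in U :\: B -> `|h i 0| <= M].
Proof.
elim: k => [_|k IH kU].
  (* With nothing chosen yet, any bound on all entries can serve as threshold; the l1 norm is
     one. *)
  exists finset.set0, (l1norm h); split; rewrite ?finset.sub0set ?cards0 ?sumr_ge0//.
    by move=> i; rewrite inE.
  by move=> i _; rewrite /l1norm (bigD1 i)//= lerDl sumr_ge0.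
have [B [M [BU Bk M0 MB UM]]] := IH (ltnW kU).
have /card_gt0P[j0 j0P] : (0 < #|U :\: B|)%N.
  by rewrite cardsD (finset.setIidPr BU) Bk subn_gt0.
(* The largest entry left over joins the block and becomes the new threshold. *)
have [j jP jmax] := arg_maxP (fun j => `|h j 0|) j0P.
have jUB : j \in U :\: B := jP.
exists (j |: B), `|h j 0|; split => //.
- rewrite finset.subUset finset.sub1set BU andbT.
  by move: jUB; rewrite !inE => /andP[].
- by rewrite cardsU1 Bk; move: jUB; rewrite !inE => /andP[-> _].
- move=> i; rewrite !inE => /predU1P[->//|/MB]; apply: le_trans; exact: UM.
- move=> i; rewrite !inE negb_or -andbA => /and3P[_ iB iU].
  by apply: jmax; change (i \in U :\: B); rewrite inE iB.
Qed.

(** The threshold [M] bounds what remains of [U] and is at most the mean of the block [B]. If [U]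
    has at most [s] elements, the block is all of [U] and [M = 0], so the last, possibly short,
    block needs no separate treatment. The nonemptiness clause makes the recursive removal of blocks
    terminate. *)
Lemma top_subset h U (s : nat) : (0 < s)%N ->
  exists B (M : R), [/\ B \subset U, (#|B| <= s)%N,
    U != finset.set0 -> B != finset.set0, 0 <= M &
    (forall i, i \in U :\: B -> `|h i 0| <= M) /\
    Num.sqrt s%:R * M <= l1norm (restr B h) / Num.sqrt s%:R].
Proof.
move=> s0; have [Us|sU] := leqP #|U| s.
  exists U, 0; split => //; split; first by move=> i; rewrite finset.setDv inE.
  by rewrite mulr0 divr_ge0 ?sqrtr_ge0// sumr_ge0.
have [B [M [BU Bs M0 MB UM]]] := top_subset_card h (ltnW sU).
exists B, M; split => //; rewrite ?Bs//; first by rewrite -!card_gt0 Bs.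
split => //; rewrite ler_pdivlMr ?sqrtr_gt0 ?ltr0n//.
rewrite mulrAC -expr2 sqr_sqrtr// l1norm_restr -Bs mulr_natl -sumr_const.
exact: ler_sum.
Qed.

(* Cutting [U] into blocks of [s] entries of decreasing size, the largest entry
   of a block is at most the average over the preceding block. *)
Lemma sorted_blocks_le h (g : {set 'I_m} -> R) (s : nat) (c M : R) U :
    (0 < s)%N -> 0 <= c -> 0 <= M ->
    (forall B C, B \subset U -> C \subset U -> [disjoint B & C]%B ->
      g (B :|: C) <= g B + g C) ->
    (forall B, B \subset U -> (#|B| <= s)%N -> g B <= c * l2norm (restr B h)) ->
    (forall i, i \in U -> `|h i 0| <= M) ->
  g U <= c * (Num.sqrt s%:R * M + l1norm (restr U h) / Num.sqrt s%:R).
Proof.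
move=> s0 c0; have [k] := ubnP #|U|.
elim: k U M => // k IH U M Uk M0 gD gB hM.
have [U0|U0] := eqVneq U finset.set0.
  apply: (le_trans (gB _ _ _)); rewrite ?U0 ?cards0 ?finset.sub0set//.
  rewrite restr0 l2norm0 mulr0 mulr_ge0// addr_ge0 ?divr_ge0 ?mulr_ge0 ?sqrtr_ge0//.
  by rewrite sumr_ge0.
(* Peel off the top block: [g B] is paid for by the old threshold [M], and the rest of [U] satisfies
   the induction hypothesis with the new threshold [M']. *)
have [B [M' [BU Bs /(_ U0) B0 M'0 [UM' MB]]]] := top_subset h U s0.
have UBU : U :\: B \subset U by exact: finset.subsetDl.
have BUB := disjoint_setD B U.
have UE : U = B :|: (U :\: B) by rewrite -{1}(finset.setIidPr BU) finset.setID.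
have gB1 : g B <= c * (Num.sqrt s%:R * M).
  apply: (le_trans (gB _ BU Bs)); rewrite ler_wpM2l//.
  by apply: l2norm_restr_le_sup => // i /(fintype.subsetP BU)/hM.
have gUB : g (U :\: B) <=
    c * (Num.sqrt s%:R * M' + l1norm (restr (U :\: B) h) / Num.sqrt s%:R).
  apply: IH => //.
  - rewrite -ltnS (leq_trans _ Uk)// ltnS cardsD (finset.setIidPr BU).
    by rewrite -subSn ?subset_leq_card// leq_subLR -add1n leq_add2r card_gt0.
  - by move=> C D CU DU; apply: gD; exact: fintype.subset_trans UBU.
  - by move=> C CU; apply: gB; exact: fintype.subset_trans UBU.
(* The term sqrt s * [M'] is absorbed by the share of [B] in the l1 norm on [U], which is [MB]. *)
rewrite [in leLHS]UE (le_trans (gD _ _ BU UBU BUB))//.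
rewrite (le_trans (lerD gB1 gUB))// -mulrDr ler_wpM2l// lerD2l.
by rewrite [in leRHS]UE l1norm_restrU// mulrDl lerD2r.
Qed.

End SortedBlocks.

(** * Consequences of the restricted isometry property *)

Section RestrictedIsometry.
Context {R : realType} {n m : nat}.
Implicit Types (A : 'M[R]_(n, m)) (x y h : 'cV[R]_m) (S U : {set 'I_m}).

(** Testing the property on a standard basis vector gives 1 - d <= 1 + d. *)
Lemma rip_ge0 A (k : nat) (d : R) : (0 < m)%N -> (0 < k)%N ->
  restricted_isometry A k d -> 0 <= d.
Proof.
move=> m0 k0 rip; pose x : 'cV[R]_m := delta_mx (Ordinal m0) 0.
have x1 : l2norm x ^+ 2 = 1.
  rewrite l2norm_sqr /dot (bigD1 (Ordinal m0))//= big1 => [|i /negPf ni].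
    by rewrite !mxE !eqxx mul1r addr0.
  by rewrite !mxE ni mul0r.
have xk : (l0norm x <= k)%N.
  rewrite (leq_trans _ k0)// -(cards1 (Ordinal m0)).
  apply/subset_leq_card/fintype.subsetP => i; rewrite !inE mxE eqxx andbT.
  by case: (i == _); rewrite ?eqxx.
by have /andP[lo hi] := rip x xk; move: (le_trans lo hi); rewrite x1; lra.
Qed.

(** Polarization: with a = |u| and b = |v|, orthogonality gives b u + a v and b u - a v the same
    squared norm 2 a^2 b^2. The upper isometry bound for the first minus the lower one for the
    second yields 4 a b <Au, Av> <= 4 d a^2 b^2. *)
Lemma rip_dot A (k : nat) (d : R) S U x y : restricted_isometry A k d ->
  [disjoint S & U]%B -> (#|S :|: U| <= k)%N ->
  dot (A *m restr S x) (A *m restr U y) <=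
    d * (l2norm (restr S x) * l2norm (restr U y)).
Proof.
move=> rip SU SUk; set u := restr S x; set v := restr U y.
set a := l2norm u; set b := l2norm v.
have [a0|a0] := eqVneq a 0.
  by rewrite a0 mul0r mulr0 (l2norm0_eq0 a0) mulmx0 dot0l.
have [b0|b0] := eqVneq b 0.
  by rewrite b0 !mulr0 (l2norm0_eq0 b0) mulmx0 dot0r.
have ab0 : 0 < a * b by rewrite mulr_gt0// lt_def ?a0 ?b0 l2norm_ge0.
have uv c : (l0norm (b *: u + c *: v)%R <= k)%N.
  rewrite -[X in l0norm X](_ : restr (S :|: U) (b *: u + c *: v) = _).
    exact: l0norm_restr.
  apply/matrixP => i j; rewrite !mxE inE; case: (i \in S); case: (i \in U) => //=.
  by rewrite ?mulr0 ?addr0 ?add0r.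
have uv0 : dot u v = 0 by exact: dot_restr_disjoint.
have nE c : l2norm (b *: u + c *: v) ^+ 2 = b ^+ 2 * a ^+ 2 + c ^+ 2 * b ^+ 2.
  rewrite l2norm_sqr !(dotDl, dotDr, dotZl, dotZr) (dotC v u) uv0.
  by rewrite -!l2norm_sqr -/a -/b; ring.
have AE c : l2norm (A *m (b *: u + c *: v)) ^+ 2 = b ^+ 2 * l2norm (A *m u) ^+ 2
    + c ^+ 2 * l2norm (A *m v) ^+ 2 + 2 * (b * c * dot (A *m u) (A *m v)).
  rewrite !(l2norm_sqr (A *m _)) mulmxDr -!scalemxAr !(dotDl, dotDr, dotZl, dotZr).
  rewrite (dotC (A *m v) (A *m u)); ring.
have /andP[_] := rip _ (uv a); have /andP[+ _] := rip _ (uv (- a)).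
rewrite !nE !AE => lo hi.
rewrite -(ler_pM2l ab0); move: lo hi.
by move: (dot _ _) (l2norm _) (l2norm _) => p q r; nra.
Qed.

(* The argument of Candes; [U] adds to [S] the [s] largest entries of [h]
   outside [S]. *)
Lemma rip_block_estimate A (s : nat) (d : R) S h : (0 < m)%N -> (0 < s)%N ->
  restricted_isometry A (2 * s)%N d -> (#|S| <= s)%N ->
  exists U : {set 'I_m},
    [/\ S \subset U,
        l2norm (restr (~: U) h) <= l1norm (restr (~: S) h) / Num.sqrt s%:R &
        (1 - d) * l2norm (restr U h) <= Num.sqrt (1 + d) * l2norm (A *m h) +
          Num.sqrt 2 * d * (l1norm (restr (~: S) h) / Num.sqrt s%:R)].
Proof.
move=> m0 s0 rip Ss.
have d0 : 0 <= d by apply: rip_ge0 rip => //; rewrite muln_gt0.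
have [B [M [BS Bs _ M0 [SM MB]]]] := top_subset h (~: S) s0.
have SB : [disjoint S & B]%B.
  by rewrite disjoint_sym finset.disjoints_subset.
have UE : ~: (S :|: B) = ~: S :\: B by rewrite finset.setCU finset.setDE.
pose V := ~: (S :|: B).
have VM i : i \in V -> `|h i 0| <= M by rewrite /V UE; exact: SM.
have SCE : l1norm (restr (~: S) h) = l1norm (restr B h) + l1norm (restr V h).
  rewrite -l1norm_restrU /V ?UE ?disjoint_setD//.
  by rewrite -{1}(finset.setIidPr BS) finset.setID.
have Uk : (#|S :|: B| <= 2 * s)%N.
  by rewrite mul2n -addnn (leq_trans (leq_card_setU _ _).1)// leq_add.
set u := restr (S :|: B) h.
(* The block decomposition of [V] serves twice: with the Euclidean norm of the restriction as [g],
   and with the cross term between [A u] and the image of the restriction. The initial threshold [M]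
   is absorbed by the l1 norm on [B]. *)
have tail (g : {set 'I_m} -> R) (c : R) : 0 <= c ->
    (forall B C : {set 'I_m}, B \subset V -> C \subset V -> [disjoint B & C]%B ->
      g (B :|: C) <= g B + g C) ->
    (forall B : {set 'I_m}, B \subset V -> (#|B| <= s)%N ->
      g B <= c * l2norm (restr B h)) ->
  g V <= c * (l1norm (restr (~: S) h) / Num.sqrt s%:R).
  move=> c0 gD gB; apply: (le_trans (sorted_blocks_le s0 c0 M0 gD gB VM)).
  by rewrite ler_wpM2l// SCE mulrDl lerD2r.
(* The two parts of [u] are orthogonal, and (p + q)^2 <= 2 (p^2 + q^2); this is the origin of the
   factor sqrt 2. *)
have sq2 : l2norm (restr S h) + l2norm (restr B h) <= Num.sqrt 2 * l2norm u.
  rewrite -ler_sqr ?nnegrE ?addr_ge0 ?mulr_ge0 ?sqrtr_ge0 ?l2norm_ge0//.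
  rewrite exprMn sqr_sqrtr// l2norm_sqr /u restrU// dotDl !dotDr.
  rewrite (dotC (restr B h) (restr S h)) (dot_restr_disjoint _ _ SB) -!l2norm_sqr.
  by have := sqr_ge0 (l2norm (restr S h) - l2norm (restr B h)); nra.
exists (S :|: B); split; first exact: finset.subsetUl.
  rewrite -[leRHS]mul1r.
  apply: (tail (fun C => l2norm (restr C h))) => // [C D _ _ CD|C _ _].
    by rewrite restrU// ler_l2normD.
  by rewrite mul1r.
have [u0|u0] := eqVneq (l2norm u) 0.
  rewrite -/u u0 mulr0 addr_ge0// ?divr_ge0 ?mulr_ge0 ?sqrtr_ge0 ?l2norm_ge0//.
  by rewrite sumr_ge0.
have u_gt0 : 0 < l2norm u by rewrite lt_def u0 l2norm_ge0.
have crossV : - dot (A *m u) (A *m restr V h) <=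
    (Num.sqrt 2 * d * l2norm u) * (l1norm (restr (~: S) h) / Num.sqrt s%:R).
  apply: (tail (fun C => - dot (A *m u) (A *m restr C h))).
  - by rewrite !mulr_ge0 ?sqrtr_ge0.
  - by move=> C D _ _ CD; rewrite restrU// mulmxDr dotDr opprD.
  - move=> C CV Cs.
    (* The support of [u] may already have 2s indices, too many to be joined with [C]. Hence [u] is
       split into its parts on [S] and [B], each of which makes at most 2s indices together with
       [C]. *)
    have key (E : {set 'I_m}) : E \subset S :|: B -> (#|E| <= s)%N ->
        - dot (A *m restr E h) (A *m restr C h) <=
          d * (l2norm (restr E h) * l2norm (restr C h)).
      move=> EU Es; rewrite -dotNr -mulmxN.
      have -> : - restr C h = restr C (- h).
        by apply/matrixP => i j; rewrite !mxE; case: ifP; rewrite ?oppr0.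
      have -> : l2norm (restr C h) = l2norm (restr C (- h)).
        rewrite -l2normN; congr l2norm.
        by apply/matrixP => i j; rewrite !mxE; case: ifP; rewrite ?oppr0.
      apply: rip_dot rip _ _.
        rewrite disjoint_sym finset.disjoints_subset.
        by rewrite (fintype.subset_trans CV)// finset.setCS.
      by rewrite mul2n -addnn (leq_trans (leq_card_setU _ _).1)// leq_add.
    have kS := key S (finset.subsetUl _ _) Ss.
    have kB := key B (finset.subsetUr _ _) Bs.
    rewrite {1}/u restrU// mulmxDr dotDl opprD (le_trans (lerD kS kB))//.
    rewrite -mulrDr -mulrDl [leRHS](_ : _ = d * (Num.sqrt 2 * l2norm u *
      l2norm (restr C h))); last by ring.
    by rewrite ler_wpM2l// ler_wpM2r// l2norm_ge0.
have /andP[lo hi] := rip u (l0norm_restr h Uk).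
have Au : l2norm (A *m u) <= Num.sqrt (1 + d) * l2norm u.
  have d1 : 0 <= 1 + d by rewrite addr_ge0.
  rewrite -ler_sqr ?nnegrE ?mulr_ge0 ?sqrtr_ge0 ?l2norm_ge0//.
  by rewrite exprMn (sqr_sqrtr d1).
(* Writing u = h - [restr V h] in one factor of |A u|^2 brings in A h. The result lies above (1 - d)
   |u|^2 and below [crossh] plus [crossV], and one factor |u| cancels. *)
have AuE : l2norm (A *m u) ^+ 2 =
    dot (A *m u) (A *m h) - dot (A *m u) (A *m restr V h).
  rewrite [X in dot _ (_ *m X) - _](restrC (S :|: B) h) -/u -/V.
  by rewrite mulmxDr dotDr addrK l2norm_sqr.
have crossh : dot (A *m u) (A *m h) <=
    Num.sqrt (1 + d) * l2norm u * l2norm (A *m h).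
  by rewrite (le_trans (dot_le _ _))// ler_wpM2r// l2norm_ge0.
rewrite -(ler_pM2l u_gt0); move: lo; rewrite AuE => lo.
rewrite (_ : l2norm u * _ = (1 - d) * l2norm u ^+ 2) -/u; last by ring.
apply: (le_trans lo); apply: (le_trans (lerD crossh crossV)).
rewrite le_eqVlt; apply/orP; left; apply/eqP; ring.
Qed.

End RestrictedIsometry.

(** * Norm bound for integrals of vector-valued functions *)

Section VectorIntegral.
Context d {X : measurableType d} {R : realType} (mu : {measure set X -> \bar R}).

Lemma integrable_dot {m} (D : set X) (v : 'cV[R]_m) (g : X -> 'cV[R]_m) :
  measurable D -> (forall i, mu.-integrable D (fun t => (g t i 0)%:E)) ->
  mu.-integrable D (fun t => (dot v (g t))%:E).
Proof.
move=> mD ig; rewrite /dot.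
under eq_fun do rewrite -sumEFin.
apply: integrable_sum => // i _.
under eq_fun do rewrite EFinM.
exact: integrableZl.
Qed.

Lemma Rintegral_dot {m} (D : set X) (v : 'cV[R]_m) (g : X -> 'cV[R]_m) :
  measurable D -> (forall i, mu.-integrable D (fun t => (g t i 0)%:E)) ->
  \int[mu]_(t in D) dot v (g t) = \sum_i v i 0 * \int[mu]_(t in D) g t i 0.
Proof.
move=> mD ig; rewrite /Rintegral /dot.
under eq_integral do rewrite -sumEFin.
rewrite integral_sum//; last first.
  move=> i; under eq_fun do rewrite EFinM; exact: integrableZl.
rewrite -sum_fine; last first.
  move=> i _; apply: integrable_fin_num => //.
  under eq_fun do rewrite EFinM; exact: integrableZl.
by apply: eq_bigr => i _; rewrite -RintegralZl//; exact: ig.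
Qed.

(* Test the integral against itself: |v|^2 is the integral of <v, g>. *)
Lemma l2norm_Rintegral_le {m} (D : set X) (v : 'cV[R]_m) (g : X -> 'cV[R]_m)
    (c l : R) :
  measurable D -> mu D = l%:E -> 0 <= c ->
  (forall i, mu.-integrable D (fun t => (g t i 0)%:E)) ->
  (forall i, v i 0 = \int[mu]_(t in D) g t i 0) ->
  {ae mu, forall t, D t -> l2norm (g t) <= c} ->
  l2norm v <= c * l.
Proof.
move=> mD muD c0 ig vE gc.
have l0 : 0 <= l by rewrite -lee_fin -muD.
have [v0|v0] := eqVneq (l2norm v) 0; first by rewrite v0 mulr_ge0.
have v_gt0 : 0 < l2norm v by rewrite lt_def v0 l2norm_ge0.
rewrite -(ler_pM2l v_gt0) -expr2 l2norm_sqr.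
have -> : dot v v = \int[mu]_(t in D) dot v (g t).
  by rewrite Rintegral_dot//; apply: eq_bigr => i _; rewrite -vE.
have iv := integrable_dot v mD ig.
apply: (le_trans (ler_norm _)); rewrite -lee_fin EFin_normr_Rintegral//.
have mv := measurable_int _ iv.
apply: (le_trans (le_abse_integral _ _ _)) => //.
rewrite mulrA EFinM -muD -integral_cst//.
apply: ae_ge0_le_integral => //.
- exact: measurableT_comp mv.
- by move=> t Dt; rewrite lee_fin mulr_ge0// l2norm_ge0.
move: gc; apply: filterS => t gt Dt; rewrite /= lee_fin.
by rewrite (le_trans (normr_dot_le _ _))// ler_wpM2l ?l2norm_ge0// gt.
Qed.

End VectorIntegral.

(** * Intervals under the completed Lebesgue measure *)

Section CompletedLebesgue.
Context {R : realType}.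
Local Notation mu := (@completed_lebesgue_measure R).

Lemma measurable_itv_completed (i : interval R) :
  measurable ([set` i] : set (caratheodory_type
    (@mu_ext _ _ R (@wlength R idfun)))).
Proof. by apply: sub_caratheodory; exact: measurable_itv. Qed.

Lemma completed_lebesgue_measure_itvoc (a b : R) : a <= b ->
  mu `]a, b] = (b - a)%:E.
Proof.
(* Both measures restrict the same outer measure, so they agree by conversion. *)
move=> ab; have -> : mu `]a, b] = lebesgue_measure `]a, b] by [].
rewrite lebesgue_measure_itv/= lte_fin; case: ltP => [_|ba].
  by rewrite EFinB.
by rewrite (le_anti (_ : a <= b <= a)) ?subrr// ab.
Qed.

End CompletedLebesgue.

(** * Gronwall estimate for the difference of two solutions *)

Section FlowPerturbation.
Context {R : realType} {m : nat}.
Local Notation mu := (@completed_lebesgue_measure R).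
Context (f : R -> 'cV[R]_m -> 'cV[R]_m) (T L : R) (Lt : R -> R).
Context (hLip : lipschitz_snd f T Lt) (hLt : Linfty_norm_on T Lt L) (hL : 0 < L).
Context (zx zy : 'cV[R]_m) (x y : R -> 'cV[R]_m).
Context (hx : ivp_solution f T zx x) (hy : ivp_solution f T zy y).

Lemma Linfty_norm_on_ae :
  {ae mu, forall t, t \in `[0, T] -> Lt t <= L}.
Proof.
(* The branch in which the norm is 0 by convention contradicts [0 < L]; in the other one it is an
   essential supremum. *)
case: hLt => _; rewrite unlock; case: ifPn => [_ LE|_ [L0]]; last first.
  by move: hL; rewrite -L0 ltxx.
move/eqP: LE; rewrite eq_le => /andP[/ess_supP + _].
apply: filterS => t /= tL tT; move: tL; rewrite lee_fin patchE.
by rewrite mem_set//; apply: le_trans; exact: ler_norm.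
Qed.

Let u t := y t - x t.

(** The increment is the integral over ]a, b] of f(t, y(t)) - f(t, x(t)), whose norm is at most
    [L * M] for almost every t. *)
Lemma ivp_diff_increment_le (a b M : R) : 0 <= a -> a <= b -> b <= T -> 0 <= M ->
  (forall t, t \in `[a, b] -> l2norm (u t) <= M) ->
  l2norm (u b - u a) <= L * M * (b - a).
Proof.
move=> a0 ab bT M0 uM; have [_ ix xE] := hx; have [_ iy yE] := hy.
have aT : a \in `[0, T] by rewrite in_itv/= a0 (le_trans ab).
have bT' : b \in `[0, T] by rewrite in_itv/= bT (le_trans a0).
have mI i : measurable ([set` i] : set (caratheodory_type
    (@mu_ext _ _ R (@wlength R idfun)))) := measurable_itv_completed i.
have sub (c d : R) : 0 <= c -> d <= T -> `]c, d] `<=` `[0, T].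
  move=> c0 dT t /=; rewrite !in_itv/= => /andP[ct td].
  by rewrite (le_trans c0 (ltW ct)) (le_trans td).
have sub0 (d : R) : d <= T -> `[0, d] `<=` `[0, T].
  move=> dT t /=; rewrite !in_itv/= => /andP[-> td].
  by rewrite (le_trans td).
(* The half-open interval makes the splitting of [0, b] at a disjoint. *)
have incr z w : ivp_solution f T z w -> forall i,
    w b i 0 - w a i 0 = \int[mu]_(t in `]a, b]) f t (w t) i 0.
  move=> [_ iw wE] i; rewrite !wE// opprD addrACA subrr add0r.
  have -> : `[0, b]%classic = `[0, a]%classic `|` `]a, b]%classic.
    by apply: itv_bndbnd_setU; rewrite bnd_simp.
  rewrite Rintegral_setU//.
  - by rewrite addrAC subrr add0r.
  - rewrite -itv_bndbnd_setU ?bnd_simp//.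
    by apply: integrableS (iw i) => //; exact: sub0.
  - apply/disj_setPS => t [] /=; rewrite !in_itv/= => /andP[_ ta] /andP[at' _].
    by move: (lt_le_trans at' ta); rewrite ltxx.
apply: (@l2norm_Rintegral_le _ _ _ mu m `]a, b] _
  (fun t => f t (y t) - f t (x t))) => //.
- exact: completed_lebesgue_measure_itvoc.
- by rewrite mulr_ge0// ltW.
- move=> i.
  apply: (@eq_integrable _ _ _ mu `]a, b] (mI _)
    (fun t => (f t (y t) i 0)%:E - (f t (x t) i 0)%:E)%E).
    by move=> t _; rewrite !mxE.
  by apply: integrableB => //; [apply: integrableS (iy i)|
    apply: integrableS (ix i)] => //; exact: sub.
- move=> i; rewrite !mxE.
  under eq_Rintegral do rewrite !mxE.
  rewrite RintegralB//; last 2 first.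
  + by apply: integrableS (iy i) => //; exact: sub.
  + by apply: integrableS (ix i) => //; exact: sub.
  by rewrite -(incr _ _ hx) -(incr _ _ hy); ring.
- have := Linfty_norm_on_ae.
  apply: (@filterS _ _ (ae_filter_ringOfSetsType mu)) => t LtL tab.
  have tT : t \in `[0, T] by exact: (sub _ _ a0 bT).
  rewrite (le_trans (hLip tT _ _))//.
  apply: (le_trans (ler_wpM2r (l2norm_ge0 _) (LtL tT))).
  rewrite ler_wpM2l// ?(ltW hL)//; apply: uM.
  by move: tab => /=; rewrite !in_itv/= => /andP[/ltW-> ->].
Qed.


Lemma ivp_solution0 z w : 0 <= T -> ivp_solution f T z w -> w 0 = z.
Proof.
move=> T0 [_ iw wE]; apply/matrixP => i j; rewrite ord1 wE ?in_itv/= ?lexx//.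
rewrite /Rintegral null_set_integral ?addr0//.
- exact: measurable_itv_completed.
- apply: (measurable_int mu).
  apply: integrableS (iw i); try exact: measurable_itv_completed.
  by move=> t /=; rewrite !in_itv/= => /andP[-> /le_trans->].
- have mu00 : lebesgue_measure (`[0, 0]%classic : set R) = 0%E.
    by rewrite lebesgue_measure_itv/= ltxx.
  exact: mu00.
Qed.

(** The extreme value theorem is applied to the squared norm, whose continuity follows from that of
    the coordinates by sums and products. *)
Lemma ivp_diff_max (a b : R) : 0 <= a -> a <= b -> b <= T ->
  exists2 c, c \in `[a, b] & forall t, t \in `[a, b] -> l2norm (u t) <= l2norm (u c).
Proof.
move=> a0 ab bT; have [cx _ _] := hx; have [cy _ _] := hy.
have cu : {within `[a, b], continuous (fun t => dot (u t) (u t))}.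
  apply: (@continuous_subspaceW _ _ _ `[0, T]).
    move=> t /=; rewrite !in_itv/= => /andP[at' tb].
    by rewrite (le_trans a0) ?(le_trans tb).
  move=> t; apply: cvg_big => [|i _]; first exact: add_continuous.
  have cuti : {for t, continuous ((fun s => u s i 0) : subspace `[0, T] -> R)}.
    have -> : (fun s => u s i 0) = (fun s => y s i 0 - x s i 0).
      by apply/funext => s; rewrite !mxE.
    apply: cvgB.
      exact: (continuous_comp (cy t) (@coord_continuous _ _ _ _ _ _)).
    exact: (continuous_comp (cx t) (@coord_continuous _ _ _ _ _ _)).
  exact: (cvgM cuti cuti).
have [c cab cmax] := EVT_max ab cu; exists c => // t /cmax.
by rewrite -!l2norm_sqr ler_sqr ?nnegrE ?l2norm_ge0.
Qed.

(** Let M be the maximum of |u| on [a, b] and z = L (b - a). The increment up to the point of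
    maximum gives M <= |u a| + z M, so M <= q |u a|; the increment up to b is then at most z M <= z
    q |u a|, and z q = q - 1. *)
Lemma ivp_diff_step_le (a b q : R) : 0 <= a -> a <= b -> b <= T ->
  L * (b - a) < 1 -> q = (1 - L * (b - a))^-1 ->
  l2norm (u b - u a) <= (q - 1) * l2norm (u a).
Proof.
move=> a0 ab bT z1 qE; set z := L * (b - a) in z1 qE.
have [c] := ivp_diff_max a0 ab bT; rewrite in_itv/= => /andP[ac cb] cmax.
have z0 : 0 <= z by rewrite mulr_ge0 ?(ltW hL)// subr_ge0.
set M := l2norm (u c) in cmax; have M0 : 0 <= M := l2norm_ge0 _.
have uca : l2norm (u c - u a) <= L * M * (c - a).
  apply: ivp_diff_increment_le => //; first exact: le_trans bT.
  move=> t; rewrite in_itv/= => /andP[at' tc]; apply: cmax.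
  by rewrite in_itv/= at' (le_trans tc).
have uba : l2norm (u b - u a) <= L * M * (b - a).
  exact: ivp_diff_increment_le.
have MD : M <= l2norm (u a) + l2norm (u c - u a) := ler_l2norm_addB _ _.
have LM0 : 0 <= L * M by rewrite mulr_ge0// ltW.
have zM : (1 - z) * M <= l2norm (u a) by rewrite /z; nra.
have q1 : q - 1 = z * q by rewrite qE; field; rewrite subr_eq0 gt_eqF.
apply: (le_trans uba); rewrite q1 (_ : L * M * (b - a) = z * M); last first.
  by rewrite /z; ring.
rewrite -mulrA ler_wpM2l// qE ler_pdivlMl// subr_gt0//.
Qed.

(* Split [0, T] into N steps and put z = L T / N. Over a step the difference of
   the solutions grows by at most the factor q = 1 / (1 - z), and q ^ N is at
   most exp (N (q - 1)), which is below exp Lam for large N. *)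
Lemma ivp_diff_drift_le (Lam : R) : 0 < T -> L * T < Lam ->
  l2norm (u T - (zy - zx)) <= (expR Lam - 1) * l2norm (zy - zx).
Proof.
move=> T0 LTLam; set th := L * T in LTLam.
have th0 : 0 < th by rewrite mulr_gt0.
have Lam0 : 0 < Lam by exact: lt_trans LTLam.
have -> : zy - zx = u 0.
  by rewrite /u (ivp_solution0 (ltW T0) hx) (ivp_solution0 (ltW T0) hy).
(* With z = th / N, the wanted bound th / (1 - z) <= Lam amounts to N >= th Lam / (Lam - th). The
   strict inequality [th < Lam] makes a finite [N] suffice, without a limit. *)
pose N := Num.bound (th * Lam / (Lam - th)).
have NP : th * Lam / (Lam - th) < N%:R.
  by apply: archi_boundP; rewrite divr_ge0 ?subr_ge0 ?ltW// mulr_gt0.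
have N0 : 0 < N%:R :> R.
  by apply: le_lt_trans NP; rewrite divr_ge0 ?subr_ge0 ?ltW// mulr_gt0.
pose z := th / N%:R; pose q := (1 - z)^-1.
have z0 : 0 < z by rewrite divr_gt0.
have zLam : th <= Lam * (1 - z).
  move: NP; rewrite ltr_pdivrMr ?subr_gt0// => NP.
  have : z * Lam <= Lam - th.
    by rewrite /z mulrAC ler_pdivrMr// mulrC mulrC [leRHS]mulrC ltW.
  by lra.
have z1 : 0 < 1 - z by rewrite -(pmulr_rgt0 _ Lam0) (lt_le_trans th0).
have q1 : 1 <= q by rewrite invf_ge1// gerBl ltW.
(* The induction follows the distance from [u 0]. It also gives |v| <= q^k |u 0|, so the next step
   adds at most (q^(k+1) - q^k) |u 0|. *)
have steps k : (k <= N)%N ->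
    l2norm (u (k%:R * (T / N%:R)) - u 0) <= (q ^+ k - 1) * l2norm (u 0).
  elim: k => [_|k IH kN].
    by rewrite mul0r expr0 !subrr mul0r l2norm0.
  have := IH (ltnW kN); set v := u (k%:R * _) => vle.
  have TN : 0 < T / N%:R by rewrite divr_gt0.
  have : l2norm (u (k.+1%:R * (T / N%:R)) - v) <= (q - 1) * l2norm v.
    have step : k.+1%:R * (T / N%:R) - k%:R * (T / N%:R) = T / N%:R.
      by rewrite -mulrBl -natrB// subSnn mul1r.
    apply: ivp_diff_step_le.
    - by rewrite mulr_ge0 // ltW.
    - by rewrite -subr_ge0 step ltW.
    - by rewrite mulrA ler_pdivrMr// mulrC ler_wpM2l ?(ltW T0)// ler_nat.
    - by rewrite step mulrA -subr_gt0.
    - by rewrite step mulrA.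
  have vD : l2norm v <= l2norm (u 0) + l2norm (v - u 0) := ler_l2norm_addB _ _.
  move=> wle; have wD : l2norm (u (k.+1%:R * (T / N%:R)) - u 0) <=
      l2norm (u (k.+1%:R * (T / N%:R)) - v) + l2norm (v - u 0).
    by rewrite (le_trans _ (ler_l2normD _ _))// addrA subrK.
  have vq : (q - 1) * l2norm v <= (q - 1) * (q ^+ k * l2norm (u 0)).
    by rewrite ler_wpM2l ?subr_ge0//; lra.
  rewrite exprS; lra.
have := steps N (leqnn N); rewrite mulrCA divff ?gt_eqF// mulr1 => /le_trans; apply.
rewrite ler_wpM2r ?l2norm_ge0// lerD2r.
have qexp : q <= expR (q - 1) by have := expR_ge1Dx (q - 1); lra.
apply: (@le_trans _ _ (expR (q - 1) ^+ N)).
  by rewrite lerXn2r// nnegrE ?expR_ge0// (le_trans ler01).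
rewrite -expRM_natl ler_expR (_ : q - 1 = z * q); last first.
  by rewrite /q; field; rewrite gt_eqF.
by rewrite mulrA /z mulrCA divff ?gt_eqF// mulr1 /q ler_pdivrMr.
Qed.

End FlowPerturbation.

(** * Cone condition from weighted l1 minimality *)

Section WeightedCone.
Context {R : realType} {m : nat}.
Context (w : 'I_m -> R) (m_gt0 : (0 < m)%N) (w_gt0 : forall i, 0 < w i).

Lemma le_wmax i : w i <= wmax w.
Proof. exact: le_bigmax. Qed.

Lemma wmin_le i : wmin w <= w i.
Proof. exact: bigmin_le. Qed.

Lemma wmax_gt0 : 0 < wmax w.
Proof. exact: lt_le_trans (w_gt0 (Ordinal m_gt0)) (le_wmax _). Qed.

Lemma wmin_gt0 : 0 < wmin w.
Proof. by apply: lt_bigmin => //; exact: wmax_gt0. Qed.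

(** By hypothesis the weighted sum of |x_i| - |z_i| is nonnegative. Each term is at most |z_i - x_i|
    on [S] and at most 2 |x_i| - |z_i - x_i| off [S]. Replacing the weights by [wmin w] on the left
    and [wmax w] on the right produces the ratio. *)
Lemma weighted_cone (S : {set 'I_m}) (x z : 'cV[R]_m) : wl1norm w z <= wl1norm w x ->
  l1norm (restr (~: S) (z - x)) <= wmax w / wmin w *
    (l1norm (restr S (z - x)) + 2 * l1norm (restr (~: S) x)).
Proof.
move=> zx; rewrite mulrAC ler_pdivlMr ?wmin_gt0// mulrC !l1norm_restr.
have split_sum (F : 'I_m -> R) :
    \sum_i F i = \sum_(i in S) F i + \sum_(i in ~: S) F i.
  rewrite (bigID (mem S))/=; congr (_ + _).
  by apply: eq_bigl => i; rewrite inE.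
have : \sum_(i in ~: S) w i * `|(z - x) i 0| <= \sum_(i in S) w i * `|(z - x) i 0|
    + 2 * \sum_(i in ~: S) w i * `|x i 0|.
  have inS : \sum_(i in S) (w i * `|x i 0| - w i * `|z i 0|) <=
      \sum_(i in S) w i * `|(z - x) i 0|.
    apply: ler_sum => i _; rewrite -mulrBr ler_wpM2l ?(ltW (w_gt0 i))// !mxE.
    by rewrite distrC; exact: lerB_dist.
  have inSc : \sum_(i in ~: S) (w i * `|x i 0| - w i * `|z i 0|) <=
      \sum_(i in ~: S) (2 * (w i * `|x i 0|) - w i * `|(z - x) i 0|).
    apply: ler_sum => i _; rewrite !mxE.
    by have := ler_normB (z i 0) (x i 0); have := w_gt0 i; nra.
  move: zx inS inSc; rewrite /wl1norm !split_sum !sumrB mulr_sumr; lra.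
have Smin : wmin w * (\sum_(i in ~: S) `|(z - x) i 0|) <=
    \sum_(i in ~: S) w i * `|(z - x) i 0|.
  by rewrite mulr_sumr; apply: ler_sum => i _; rewrite ler_wpM2r// wmin_le.
have Smax (V : {set 'I_m}) (y : 'cV[R]_m) :
    \sum_(i in V) w i * `|y i 0| <= wmax w * \sum_(i in V) `|y i 0|.
  by rewrite mulr_sumr; apply: ler_sum => i _; rewrite ler_wpM2r// le_wmax.
have := Smax S (z - x); have := Smax (~: S) x.
lra.
Qed.

End WeightedCone.

(** * Assembling the recovery estimate *)

Theorem theorem2 (R : realType) (m n s : nat)
    (hm : (0 < m)%N) (hn : (0 < n)%N) (hs : (0 < s)%N)
    (T : R) (hT : 0 < T)
    (f : R -> 'cV[R]_m -> 'cV[R]_m) (Lt : R -> R) (L : R)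
    (hLip : lipschitz_snd f T Lt)
    (hLt : Linfty_norm_on T Lt L) (hL : 0 < L)
    (hsol : forall z : 'cV[R]_m, exists x, ivp_solution f T z x)
    (A : 'M[R]_(n, m)) (delta : R)
    (hdelta : isometry_constant A (2 * s)%N delta)
    (w : 'I_m -> R) (hw : forall i, 0 < w i)
    (tau : R) (htau : tau = wmax w / wmin w)
    (hdelta_lt : delta < (1 + tau * Num.sqrt 2)^-1)
    (hT_lt : T < 1 / L *
       ln (1 + (1 - delta * (1 + tau * Num.sqrt 2)) /
               ((1 + tau) * opnorm A * Num.sqrt (1 + delta)))) :
  exists C0 C1 : R,
    forall (eps : R) (x0 : 'cV[R]_m) (e : 'cV[R]_n) (x : R -> 'cV[R]_m)
           (b : 'cV[R]_n) (xstar x0s : 'cV[R]_m),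
      0 <= eps ->
      l2norm e <= eps ->
      ivp_solution f T x0 x ->
      b = A *m x T + e ->
      wl1_minimizer f T A w b eps xstar ->
      largest_part s x0 x0s ->
      l2norm (xstar - x0) <=
        C0 * (Num.sqrt s%:R)^-1 * l1norm (x0 - x0s) + C1 * eps.
Proof.
have [rip _] := hdelta.
have d0 : 0 <= delta by apply: rip_ge0 rip => //; rewrite muln_gt0.
have t0 : 0 < tau by rewrite htau divr_gt0 ?wmax_gt0 ?wmin_gt0.
set k := Num.sqrt (1 + delta) in hT_lt *; set r2 := Num.sqrt 2 in hdelta_lt hT_lt *.
have k0 : 0 < k by rewrite sqrtr_gt0 ltr_wpDr.
have r20 : 0 < r2 by rewrite sqrtr_gt0.
set E := 1 - delta * (1 + tau * r2) in hT_lt *.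
have E0 : 0 < E.
  rewrite subr_gt0 -ltr_pdivlMr ?div1r//.
  by rewrite addr_gt0// mulr_gt0.
set a := opnorm A in hT_lt *.
have a0 : 0 <= a := opnorm_ge0 A.
set X := E / _ in hT_lt *.
have X0 : 0 <= X.
  by rewrite divr_ge0 ?(ltW E0)// !mulr_ge0 ?(ltW k0)// addr_ge0 ?(ltW t0).
have LT : L * T < ln (1 + X).
  by move: hT_lt; rewrite mul1r mulrC ltr_pdivlMr// mulrC.
(* The midpoint leaves strict room on both sides: above [L * T] for the Gronwall estimate, below ln
   (1 + X) for the positivity of [D]. *)
pose Lam := (L * T + ln (1 + X)) / 2.
have [LLam LamX] : L * T < Lam /\ Lam < ln (1 + X) by rewrite /Lam; lra.
pose G := a * (expR Lam - 1).
have expX : expR Lam - 1 < X.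
  have : expR Lam < 1 + X.
    by rewrite -[1 + X]lnK ?posrE ?ltr_wpDr// ltr_expR.
  by lra.
have D0 : 0 < E - (1 + tau) * k * G.
  (* For a = 0 the denominator in [X] vanishes and cannot be cleared, but then G = 0 and the claim
     reduces to [E0]. *)
  have [a00|an0] := eqVneq a 0.
    by rewrite /G a00 mul0r mulr0 subr0.
  have a_gt0 : 0 < a by rewrite lt_def an0.
  rewrite subr_gt0 /G.
  rewrite [ltLHS](_ : _ = (expR Lam - 1) * ((1 + tau) * a * k)); last by ring.
  by rewrite -ltr_pdivlMr// !mulr_gt0// addr_gt0.
set D := E - _ in D0.
have Lam0 : 0 < Lam by apply: lt_trans LLam; rewrite mulr_gt0.
have G0 : 0 <= G by rewrite mulr_ge0// subr_ge0 -expR0 ler_expR ltW.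
(* These come from solving [Dp] below for p, the norm of h on [U], and inserting the result in |h|
   <= (1 + tau) p + 2 tau rs. *)
exists ((1 + tau) / D * (2 * k * G * tau + 2 * r2 * delta * tau) + 2 * tau),
  ((1 + tau) * 2 * k / D).
move=> eps x0 e x b xstar x0s eps0 e_eps hx bE.
move=> [[y hy by_eps] xmin] [S [S_card _ x0sE]].
set h := xstar - x0.
have Ss : (#|S| <= s)%N by rewrite S_card geq_minl.
have fx0 : feasible f T A b eps x0.
  by exists x => //; rewrite bE addrAC subrr add0r.
have cone := weighted_cone hm hw S (xmin _ fx0); rewrite -/h -htau in cone.
have [U [SU hUc hU]] := rip_block_estimate h hm hs rip Ss.
have sigE : x0 - x0s = restr (~: S) x0.
  by rewrite {1}(restrC S x0) x0sE addrAC subrr add0r.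
rewrite sigE; set sg := l1norm (restr (~: S) x0) in cone *.
have sg0 : 0 <= sg by apply: sumr_ge0.
set r := (Num.sqrt s%:R)^-1.
have sq0 : 0 < Num.sqrt s%:R :> R by rewrite sqrtr_gt0 ltr0n.
have r0 : 0 < r by rewrite invr_gt0.
set q := l1norm (restr (~: S) h) / Num.sqrt s%:R in hUc hU.
set p := l2norm (restr U h) in hU; rewrite -/k -/r2 in hU.
have qle : q <= tau * p + 2 * tau * (r * sg).
  have Sl1 : l1norm (restr S h) <= Num.sqrt s%:R * p.
    rewrite (le_trans (l1norm_restr_le _ Ss))// ler_wpM2l ?(ltW sq0)//.
    exact: l2norm_restr_le.
  rewrite ler_pdivrMr// (le_trans cone)//.
  rewrite [leRHS](_ : _ = tau * (Num.sqrt s%:R * p + 2 * sg)).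
    by rewrite ler_wpM2l ?(ltW t0)// lerD2r.
  by rewrite /r; field; rewrite gt_eqF.
have hD : l2norm h <= p + q.
  rewrite (restrC U h) (le_trans (ler_l2normD _ _))//.
  by rewrite -/p lerD2l.
have Ah : l2norm (A *m h) <= 2 * eps + G * l2norm h.
  have drift := ivp_diff_drift_le hLip hLt hL hx hy hT LLam.
  rewrite -/h in drift.
  (* The two residuals, of x0 and of xstar, are at most eps each; the last term is the image of the
     drift. *)
  have -> : A *m h = (e - (b - A *m y T)) - A *m ((y T - x T) - h).
    rewrite bE !mulmxBr; move: (A *m h) (A *m y T) (A *m x T) => v1 v2 v3.
    by apply/matrixP => i j; rewrite !mxE; ring.
  rewrite (le_trans (ler_l2normB _ _))// lerD//.
    by rewrite (le_trans (ler_l2normB _ _))//; lra.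
  rewrite (le_trans (l2norm_mulmx_le _ _))// /G -mulrA ler_wpM2l//.
have p0 : 0 <= p := l2norm_ge0 _.
have h0 : 0 <= l2norm h := l2norm_ge0 _.
have rs0 : 0 <= r * sg by rewrite mulr_ge0// ltW.
set N := l2norm h in hD Ah h0 *; set rs := r * sg in qle rs0.
have Np : N <= (1 + tau) * p + 2 * tau * rs by lra.
have kA : k * l2norm (A *m h) <= k * (2 * eps + G * N) by rewrite ler_wpM2l// ltW.
have kN : k * G * N <= k * G * ((1 + tau) * p + 2 * tau * rs).
  by rewrite ler_wpM2l// mulr_ge0// ltW.
have dq : r2 * delta * q <= r2 * delta * (tau * p + 2 * tau * rs).
  by rewrite ler_wpM2l// mulr_ge0// ltW.
(* The coefficient of p, with all its terms moved to the left, is 1 - delta - r2 delta tau - (1 +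
   tau) k G, that is, [D]. *)
have Dp : D * p <= 2 * k * eps + (2 * k * G * tau + 2 * r2 * delta * tau) * rs.
  by rewrite /D /E; lra.
have pD : p <= (2 * k * eps + (2 * k * G * tau + 2 * r2 * delta * tau) * rs) / D.
  by rewrite ler_pdivlMr// mulrC.
apply: (le_trans Np).
apply: (@le_trans _ _ ((1 + tau) * ((2 * k * eps +
    (2 * k * G * tau + 2 * r2 * delta * tau) * rs) / D) + 2 * tau * rs)).
  by rewrite lerD2r ler_wpM2l// addr_ge0// ltW.
rewrite le_eqVlt; apply/orP; left; apply/eqP; rewrite /rs.
by field; rewrite gt_eqF.
Qed.
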